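(* Let $M$ be a rooted map whose underlying directed graph is $G$ (so $G$ is connected). Then $$N(G)=\sum_{T\text{ good spanning tree of }M}\ \prod_{e\in E_G\setminus E_T}\big(x_{\alpha(e)}-x_{\omega(e)}\big).$$ In particular the right-hand side does not depend on the choice of rooted map structure on $G$.
   Context: A directed graph $G$ has finite vertex set $V_G$ and edges $E_G$, each edge $e$ having origin $\alpha(e)$ and end $\omega(e)$. A linear extension of $G$ is a total order on $V_G$ with $\alpha(e)$ before $\omega(e)$ for every edge, written as the word $w=w_1\cdots w_n$ in increasing order; $\mathcal L(G)$ is their set. $\Psi(G)=\sum_{w\in\mathcal L(G)}\prod_{i=1}^{n-1}(x_{w_i}-x_{w_{i+1}})^{-1}$ and $N(G)=\Psi(G)\prod_{e\in E_G}(x_{\alpha(e)}-x_{\omega(e)})$. A rooted map on a connected graph $G$: each edge $e$ is split into two half-edges (darts), its first dart attached to $\alpha(e)$ and its second dart attached to $\omega(e)$; a permutation $\sigma$ of the darts is given whose orbits are exactly the sets of darts attached to a common vertex (so $\sigma$ gives a cyclic order of the darts around each vertex); in addition there is an external dart $h_0$, belonging to no edge, attached to a vertex $\star$ and inserted at some place in the cyclic order around $\star$. A spanning tree $T$ of $G$ (edges orientation ignored) has edge set $E_T\subset E_G$. The tour of $T$ starting at $h_0$ is the contour walk around $T$: from the current dart $h$ at vertex $u$, pass to the next dart $\sigma(h)$ around $u$; if it is a dart of an edge of $T$, cross that edge to its other dart at the other endpoint and continue from there; if it is a dart of an edge not in $T$, record it and continue from it at $u$; stop on returning to $h_0$. This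 visits every dart of every edge not in $T$ exactly once and thus orders these darts. $T$ is called good if, for every edge $e\in E_G\setminus E_T$, the first dart of $e$ (the one at $\alpha(e)$) appears before its second dart (the one at $\omega(e)$) in the tour of $T$. *)

(* Defs.v *)
From mathcomp Require Import all_boot all_order all_algebra fingroup perm.
From mathcomp Require Import fraction mpoly.

Set Implicit Arguments.
Unset Strict Implicit.
Unset Printing Implicit Defensive.

Import GRing.Theory.
Local Open Scope ring_scope.

(* Loops, parallel edges and directed circuits are allowed. *)
Record digraph := Digraph {
  vertex : finType;
  edge : finType;
  origin : edge -> vertex;   (* alpha *)
  target : edge -> vertex    (* omega *)
}.

Section Graph.
Variable G : digraph.
Implicit Types (T : {set edge G}).

(* [(e, false)] is the first dart of [e], at its origin; [(e, true)] is the
   second one, at its end. *)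
Definition dart : finType := (edge G * bool)%type.

Definition dart_vertex (d : dart) : vertex G :=
  if d.2 then target d.1 else origin d.1.

Definition opp_dart (d : dart) : dart := (d.1, ~~ d.2).

Definition adjacent T : rel (vertex G) := fun u v =>
  [exists d : dart,
    [&& d.1 \in T, dart_vertex d == u & dart_vertex (opp_dart d) == v]].

Definition connected_by T : bool :=
  [forall u, forall v, connect (adjacent T) u v].

Definition connected : bool := connected_by [set: edge G].

(* A dart stands for its edge traversed away from the vertex of the dart; a
   cycle repeats neither edges nor vertices.  A loop is a cycle of length 1
   and two parallel edges form a cycle of length 2. *)
Definition is_cycle T (c : seq dart) : bool :=
  [&& c != [::], all (fun d => d.1 \in T) c,
      path.cycle (fun d d' => dart_vertex (opp_dart d) == dart_vertex d') c,
      uniq (map fst c) & uniq (map dart_vertex c)].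

(* Distinct edges bound the length of a cycle by [#|edge G|]; see [acyclicP]. *)
Definition acyclic T : bool :=
  [forall k : 'I_#|edge G|.+1, forall c : k.-tuple dart, ~~ is_cycle T c].

Lemma acyclicP T :
  reflect (forall c : seq dart, ~~ is_cycle T c) (acyclic T).
Proof.
apply: (iffP forallP) => [acT c | acT k]; last by apply/forallP.
apply/negP => cyc; have [_ _ _ Uc _] := and5P cyc.
have lt_c : (size c < #|edge G|.+1)%N.
  by rewrite ltnS -(size_map fst) -(card_uniqP Uc) max_card.
by have /forallP/(_ (in_tuple c)) := acT (Ordinal lt_c); rewrite /= cyc.
Qed.

Definition spanning_tree T : bool := connected_by T && acyclic T.

(* A total order on the vertices, as the word listing them increasingly. *)
Definition linear_extension (w : #|vertex G|.-tuple (vertex G)) : bool :=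
  uniq w && [forall e : edge G, (index (origin e) w < index (target e) w)%N].

Definition ratfun : fieldType := {fraction {mpoly rat[#|vertex G|]}}.

Definition xvar (v : vertex G) : ratfun := tofrac 'X_(enum_rank v).

(* [zip w (behead w)] lists the pairs of consecutive letters of [w]. *)
Definition Psi : ratfun :=
  \sum_(w : #|vertex G|.-tuple (vertex G) | linear_extension w)
    \prod_(p <- zip w (behead w)) (xvar p.1 - xvar p.2)^-1.

Definition Nnum : ratfun :=
  Psi * \prod_(e : edge G) (xvar (origin e) - xvar (target e)).

(* [None] is the external dart. *)
Definition xdart : finType := option dart.

Definition xdart_vertex (root : vertex G) (h : xdart) : vertex G :=
  if h is Some d then dart_vertex d else root.

(* [rotation] acts on all darts, the external one included: it encodes both
   the cyclic orders and the place where the external dart is inserted. *)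
Record rooted_map := RootedMap {
  root : vertex G;
  rotation : {perm xdart};
  rotation_orbits : forall h : xdart,
    porbit rotation h = [set h' | xdart_vertex root h' == xdart_vertex root h]
}.

Section Tour.
Variables (M : rooted_map) (T : {set edge G}).

Definition cross (h : xdart) : xdart :=
  if h is Some d then (if d.1 \in T then Some (opp_dart d) else h) else None.

Definition tour_step (h : xdart) : xdart := cross (rotation M h).

Lemma tour_step_inj : injective tour_step.
Proof.
have crossK : involutive cross.
  by move=> [[e b]|] //=; case eT: (e \in T); rewrite /= eT // /opp_dart /= negbK.
exact: inj_comp (inv_inj crossK) (@perm_inj _ _).
Qed.

(* As [tour_step] is injective, [orbit tour_step None] is the walk from the
   external dart until the first return to it. *)
Definition tour : seq dart :=
  [seq d <- pmap id (orbit tour_step None) | d.1 \notin T].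

Definition good : bool :=
  [forall e : edge G,
    (e \notin T) ==> (index (e, false) tour < index (e, true) tour)%N].

End Tour.

Definition good_tree_sum (M : rooted_map) : ratfun :=
  \sum_(T : {set edge G} | spanning_tree T && good M T)
    \prod_(e : edge G | e \notin T) (xvar (origin e) - xvar (target e)).

End Graph.

(* Main.v *)
(* Fix the root r.  Inserting a letter into a word at every place before another
   letter telescopes.  Hence, for a tree rooted at r, the product over its edges
   of 1/(x_child - x_parent) is the sum, over the orders in which the tree can
   grow from r, written as words w ending in r, of the product over i of
   1/(x_{w_i} - x_{w_{i+1}}).  Applied to spanning trees, and to words viewed as
   two paths hanging from r, this expands both sides over the words ending in r,
   and it suffices to compare the coefficients of one such word.

   On both sides the coefficient is a product over the letters z <> r of
   [all edges between z and later letters leave z] - [they all enter z].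
   For linear extensions, each z goes to the left end or, with sign -1, to the
   right end of the word already built.  For trees, attaching z through a dart d
   inserts the darts of z in the tour just before the other dart of the edge;
   hence, ordering the edges from z to later letters along the tour, goodness
   asks that those before the tree edge enter z and those after it leave z.
   Such sign patterns have the same signed count, whatever the other choices. *)
Require Import Defs.
From mathcomp Require Import all_boot all_order all_algebra fingroup perm.
From mathcomp Require Import fraction mpoly ring zify.

Set Implicit Arguments.
Unset Strict Implicit.
Unset Printing Implicit Defensive.

Import GRing.Theory.
Local Open Scope ring_scope.

(** * Inserting letters into words *)

Definition insert (A : Type) i (m s : seq A) := take i s ++ m ++ drop i s.

Section Insert.
Variable A : eqType.
Implicit Types (a : A) (i : nat) (m s : seq A).

Lemma insert_cons i m a s : insert i.+1 m (a :: s) = a :: insert i m s.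
Proof. by []. Qed.

Lemma rcons_insert i m s a :
  (i <= size s)%N -> rcons (insert i m s) a = insert i m (rcons s a).
Proof.
by move=> si; rewrite /insert drop_rcons // -!cats1 takel_cat // -!catA.
Qed.

Lemma perm_insert i m s : perm_eq (insert i m s) (m ++ s).
Proof. by rewrite /insert perm_catCA cat_take_drop. Qed.

Lemma index_insert_head i a s :
  a \notin s -> (i <= size s)%N -> index a (insert i [:: a] s) = i.
Proof.
move=> a_s si; rewrite index_pivot ?size_takel //.
exact: contra (@mem_take _ _ _ _) a_s.
Qed.

Lemma rem_insert i a s :
  a \notin s -> (i <= size s)%N -> rem a (insert i [:: a] s) = s.
Proof.
move=> a_s si; rewrite remE index_insert_head // /insert take_size_cat
  ?size_takel //.
by rewrite -cat_rcons drop_size_cat ?size_rcons ?size_takel // cat_take_drop.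
Qed.

Lemma insert_inj i j a s u :
    a \notin s -> a \notin u -> (i <= size s)%N -> (j <= size u)%N ->
  insert i [:: a] s = insert j [:: a] u -> i = j /\ s = u.
Proof.
move=> a_s au si uj eq_su; split.
  by rewrite -(index_insert_head a_s si) eq_su index_insert_head.
by rewrite -(rem_insert a_s si) eq_su rem_insert.
Qed.

Lemma insert_index_rem a s : a \in s -> insert (index a s) [:: a] (rem a s) = s.
Proof.
move=> a_s; have szi := size_takel (index_size a s).
rewrite /insert remE take_size_cat // drop_size_cat //.
by rewrite -[RHS](cat_take_drop (index a s)) (drop_index a_s).
Qed.

Lemma mem_drop_index i a s :
  uniq s -> a \in s -> (a \in drop i s) = (i <= index a s)%N.
Proof.
move=> Us a_s; rewrite leqNgt -in_take //; move: Us a_s.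
rewrite -{1 2}(cat_take_drop i s) cat_uniq mem_cat => /and3P[_ /hasPn disj _].
by case: (boolP (a \in drop i s)) => [/disj->|_]; rewrite ?orbF => // ->.
Qed.

Lemma index_rcons_leq a b s :
  a \in rcons s b -> (index a (rcons s b) <= size s)%N.
Proof. by rewrite -ltnS -(size_rcons s b) index_mem. Qed.

Lemma index_insert_old i a m s : a \in s -> a \notin m -> (i <= size s)%N ->
  index a (insert i m s) =
    (index a s + (if index a s < i then 0 else size m))%N.
Proof.
move=> a_s am si; have := erefl (index a s).
rewrite -{2}(cat_take_drop i s) /insert !index_cat (negPf am) in_take //.
by case: ltnP => _; lia.
Qed.

Lemma index_insert_new i a m s : a \in m -> a \notin s -> (i <= size s)%N ->
  (i <= index a (insert i m s) < i + size m)%N.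
Proof.
move=> am a_s si; rewrite /insert !index_cat am.
rewrite (contraNF (@mem_take _ _ _ _)) //.
by rewrite size_takel // leq_addr ltn_add2l index_mem.
Qed.

Lemma pmap_id_insert (m s : seq (option A)) a :
  pmap id (insert (index (Some a) s) m s) =
    insert (index a (pmap id s)) (pmap id m) (pmap id s).
Proof.
rewrite /insert !pmap_cat; elim: s => [|[b|] s IHs] //=.
by rewrite (inj_eq Some_inj); case: eqP => //= _; rewrite IHs.
Qed.

End Insert.

Section WordProduct.
Variables (F : fieldType) (V : eqType) (x : V -> F).
Implicit Types (a b z : V) (u w : seq V).

Definition word_prod w : F :=
  \prod_(p <- zip w (behead w)) (x p.1 - x p.2)^-1.

Lemma word_prod1 z : word_prod [:: z] = 1.
Proof. exact: big_nil. Qed.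

Lemma word_prod_cons2 a b w :
  word_prod [:: a, b & w] = (x a - x b)^-1 * word_prod (b :: w).
Proof. exact: big_cons. Qed.

Lemma word_prod_cat u z w :
  word_prod (u ++ z :: w) = word_prod (rcons u z) * word_prod (z :: w).
Proof.
elim: u => [|a [|b u] IHu]; first by rewrite word_prod1 mul1r.
  by rewrite /= !word_prod_cons2 word_prod1 mulr1.
by rewrite /= !word_prod_cons2 [word_prod (b :: _ ++ _)]IHu mulrA.
Qed.

Lemma word_prod_rev w : word_prod (rev w) = (-1) ^+ (size w).-1 * word_prod w.
Proof.
elim: w => [|a [|b w] IHw]; rewrite ?mul1r //.
rewrite !rev_cons -cats1 cat_rcons word_prod_cat -rev_cons IHw /=.
rewrite !word_prod_cons2 word_prod1 mulr1 -[x b - x a]opprB invrN mulrN mulrAC.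
by rewrite -mulrA exprS mulN1r mulNr.
Qed.

Hypothesis x_inj : injective x.

(* Putting [z] between consecutive letters [a] and [b] multiplies the product
   by [(a - b) / ((a - z) (z - b)) = 1 / (z - b) - 1 / (z - a)]. *)
Lemma word_prod_insert i z w (g := fun j =>
    if j is j'.+1 then (x z - x (nth z w j'))^-1 else 0) :
  uniq w -> z \notin w -> (i < size w)%N ->
  word_prod (insert i [:: z] w) = (g i.+1 - g i) * word_prod w.
Proof.
rewrite {}/g; elim: i w => [|i IHi] [|a w] //=.
  by rewrite subr0 -word_prod_cons2.
case: w => // b w /andP[aw Uw]; rewrite inE negb_or ltnS => /andP[za zw] iw.
case: i IHi iw => [_ _|i IHi iw]; last first.
  by rewrite !insert_cons !word_prod_cons2 -insert_cons IHi // mulrCA.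
rewrite /insert /= !word_prod_cons2; move: (word_prod _) => P.
move: aw zw; rewrite !inE !negb_or => /andP[ab _] /andP[zb _].
move: za ab zb; rewrite -!(inj_eq x_inj) -![x _ == _]subr_eq0.
move: (x a) (x b) (x z) => ya yb yz za ab zb.
by field; rewrite za ab zb -opprB oppr_eq0 za.
Qed.

Lemma sum_word_prod_insert q z w : uniq w -> z \notin w -> q \in w ->
  \sum_(0 <= i < (index q w).+1) word_prod (insert i [:: z] w) =
    (x z - x q)^-1 * word_prod w.
Proof.
move=> Uw zw qw; have qi : (index q w < size w)%N by rewrite index_mem.
under eq_big_nat => i iq do rewrite word_prod_insert ?(leq_trans _ qi) //.
by rewrite -big_distrl /= telescope_sumr // nth_index // subr0.
Qed.

End WordProduct.

(** * Growing rooted trees *)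

Section Growth.
Variables (D V : eqType) (c p : D -> V) (r : V).
Implicit Types (d : D) (t u : seq D).

Definition reached t := rcons (map c t) r.

(* The edge [d] attaches a new child [c d] to the vertex [p d]; the most recent
   edge comes first, so that the root [r] is the last reached vertex. *)
Fixpoint growth t : bool :=
  if t is d :: t' then
    [&& c d \notin reached t', p d \in reached t' & growth t']
  else true.

Lemma growth_consP d t : growth (d :: t) ->
  [/\ c d \notin reached t, p d \in reached t & growth t].
Proof. exact: and3P. Qed.

Lemma mem_reached t v : (v \in reached t) = (v == r) || (v \in map c t).
Proof. exact: mem_rcons. Qed.

Lemma root_reached t : r \in reached t.
Proof. by rewrite mem_reached eqxx. Qed.

Lemma child_reached t d : d \in t -> c d \in reached t.
Proof. by move=> dt; rewrite mem_reached map_f ?orbT. Qed.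

Lemma perm_reached t u : perm_eq t u -> reached t =i reached u.
Proof. by move=> tu v; rewrite !mem_reached (perm_mem (perm_map c tu)). Qed.

Lemma reached_insert i t u :
  (i <= size u)%N -> reached (insert i t u) = insert i (map c t) (reached u).
Proof.
by move=> iu; rewrite -rcons_insert ?size_map // /insert -map_take -map_drop
  -!map_cat.
Qed.

Lemma growth_uniq t : growth t -> uniq (reached t).
Proof. by elim: t => //= d t IHt /and3P[-> _ /IHt]. Qed.

Lemma growth_parent t d : growth t -> d \in t -> p d \in reached t.
Proof.
elim: t => //= a t IHt /and3P[_ pa gt].
by rewrite !inE => /predU1P[->|/(IHt gt)->]; rewrite ?pa orbT.
Qed.

Definition new_leaf d t : bool :=
  [&& c d \notin reached t, p d \in reached t & all (fun y => p y != c d) t].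

Lemma perm_new_leaf d t u : perm_eq t u -> new_leaf d t = new_leaf d u.
Proof. by move=> tu; rewrite /new_leaf !(perm_reached tu) (perm_all _ tu). Qed.

Lemma new_leaf_notin d t : new_leaf d t -> d \notin t.
Proof. by case/and3P=> dt _ _; apply: contra dt; apply: child_reached. Qed.

Lemma growth_new_leaf d t : growth (d :: t) -> new_leaf d t.
Proof.
case/growth_consP=> dt pd gt; apply/and3P; split=> //; apply/allP => y yt.
by apply: contraNneq dt => <-; apply: growth_parent.
Qed.

Lemma growth_cat_cons u d t :
    c d \notin reached (u ++ t) -> all (fun y => p y != c d) u ->
  growth (u ++ d :: t) = growth (u ++ t) && (p d \in reached t).
Proof.
elim: u => [|a u IHu] /=; first by move=> -> _; rewrite /= andbC.
rewrite inE negb_or => /andP[da dt] /andP[/negPf leaf_a leaf_u].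
have mem_ut v :
    (v \in reached (u ++ d :: t)) = (v == c d) || (v \in reached (u ++ t)).
  by rewrite (perm_reached (permEl (perm_catCA u [:: d] t))) /= inE.
by rewrite IHu // !mem_ut negb_or [c a == _]eq_sym da leaf_a !andbA.
Qed.

Lemma growth_insert i d u : new_leaf d u -> (i <= size u)%N ->
  growth (insert i [:: d] u) = growth u && (i <= index (p d) (reached u))%N.
Proof.
case/and3P=> du pu leaf iu.
rewrite growth_cat_cons ?cat_take_drop //; last first.
  by apply/allP => y /mem_take; apply: (allP leaf).
case gu: (growth u) => //=; rewrite -mem_drop_index ?growth_uniq //.
by rewrite /reached drop_rcons ?size_map // map_drop.
Qed.

Lemma index_reached_leq v u :
  v \in reached u -> (index v (reached u) <= size u)%N.
Proof. by move/index_rcons_leq; rewrite size_map. Qed.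

Lemma growth_rem d u : d \in u -> new_leaf d (rem d u) ->
  growth u =
    growth (rem d u) && (index d u <= index (p d) (reached (rem d u)))%N.
Proof.
move=> du leaf; rewrite -{1}(insert_index_rem du) growth_insert //.
by rewrite size_rem // -ltnS prednK ?index_mem //; case: (u) du.
Qed.

Lemma perm_growth_orders d t : growth (d :: t) ->
  perm_eq [seq u <- permutations (d :: t) | growth u]
          [seq insert i [:: d] u | u <- [seq u <- permutations t | growth u],
             i <- index_iota 0 (index (p d) (reached u)).+1].
Proof.
move=> gdt; have leaf u : perm_eq u t -> new_leaf d u.
  by move/perm_new_leaf->; apply: growth_new_leaf.
have insertP u i : u \in [seq u <- permutations t | growth u] ->
    i \in index_iota 0 (index (p d) (reached u)).+1 ->
    [/\ perm_eq u t, growth u, (i <= index (p d) (reached u))%N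
      & (i <= size u)%N].
  rewrite mem_filter mem_permutations mem_index_iota ltnS => /andP[gu ut] iu.
  have /and3P[_ pu _] := leaf u ut; split=> //.
  exact: leq_trans iu (index_reached_leq pu).
apply: uniq_perm; first by rewrite filter_uniq ?permutations_uniq.
  apply: allpairs_uniq_dep => [|u _|];
    rewrite ?filter_uniq ?permutations_uniq //.
    exact: iota_uniq.
  move=> y y' /allpairsPdep[u [i [u_t ui ->{y}]]].
  move=> /allpairsPdep[v [j [v_t vj ->{y'}]]] /= eq_uv.
  have [ut _ _ iu] := insertP u i u_t ui.
  have [vt _ _ jv] := insertP v j v_t vj.
  have [du dv] := (new_leaf_notin (leaf u ut), new_leaf_notin (leaf v vt)).
  by have [-> ->] := insert_inj du dv iu jv eq_uv.
move=> u; rewrite mem_filter mem_permutations.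
apply/andP/allpairsPdep => [[gu ut]|[v [i [v_t vi ->]]]]; last first.
  have [vt gv iv si] := insertP v i v_t vi.
  by rewrite growth_insert ?leaf // gv iv (permPl (perm_insert _ _ _))
    perm_cons.
have du : d \in u by rewrite (perm_mem ut) mem_head.
have vt : perm_eq (rem d u) t.
  by rewrite -(perm_cons d) -(permPl (perm_to_rem du)).
exists (rem d u), (index d u).
rewrite mem_filter mem_permutations mem_index_iota ltnS vt insert_index_rem //.
by move: gu; rewrite (growth_rem du (leaf _ vt)) => /andP[-> ->].
Qed.

Lemma sum_growth_orders (F : fieldType) (x : V -> F) t :
    injective x -> growth t ->
  \sum_(u <- permutations t | growth u) word_prod x (reached u) =
    \prod_(d <- t) (x (c d) - x (p d))^-1.
Proof.
move=> x_inj; elim: t => [_|d t IHt gdt].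
  by rewrite big_cons !big_nil word_prod1 addr0.
have [dt pd gt] := growth_consP gdt.
rewrite -[LHS]big_filter (perm_big _ (perm_growth_orders gdt)).
rewrite big_allpairs_dep big_cons -IHt // big_distrr -[RHS]big_filter /=.
apply: eq_big_seq => u.
rewrite mem_filter mem_permutations => /andP[gu /perm_reached mem_u].
rewrite -sum_word_prod_insert ?growth_uniq ?mem_u //.
apply: eq_big_nat => i /andP[_]; rewrite ltnS => ip; rewrite reached_insert //.
by apply: leq_trans ip (index_reached_leq _); rewrite mem_u.
Qed.

End Growth.

(** * Words spread around the root *)

Section Shuffles.
Variable V : eqType.
Implicit Types (y z : V) (a b s : seq V) (S : seq (seq V)).

Fixpoint shuffles a : seq V -> seq (seq V) :=
  if a is z :: a' then
    fix shuffles_cons b :=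
      if b is y :: b' then
        map (cons z) (shuffles a' b) ++ map (cons y) (shuffles_cons b')
      else [:: a]
  else fun b => [:: b].

Lemma shuffles_cons2 z a y b : shuffles (z :: a) (y :: b) =
  map (cons z) (shuffles a (y :: b)) ++ map (cons y) (shuffles (z :: a) b).
Proof. by []. Qed.

Lemma shuffles_nil a : shuffles a [::] = [:: a].
Proof. by case: a. Qed.

Lemma mem_map_cons y z s S :
  (y :: s \in map (cons z) S) = (y == z) && (s \in S).
Proof.
apply/mapP/andP => [[s' Ss' [-> ->]] | [/eqP-> Ss]]; first by rewrite eqxx.
by exists s.
Qed.

Lemma mem_shuffles_cons z s a b : (z :: s \in shuffles a b) =
  (ohead a == Some z) && (s \in shuffles (behead a) b) ||
  (ohead b == Some z) && (s \in shuffles a (behead b)).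
Proof.
have eq_ohead y : (Some y == Some z) = (z == y) by rewrite eq_sym.
case: a b => [|y a] [|y' b] //; last first.
- by rewrite mem_cat !mem_map_cons /= !eq_ohead.
- by rewrite !shuffles_nil !inE eqseq_cons /= eq_ohead orbF.
by rewrite !inE eqseq_cons /= eq_ohead.
Qed.

Lemma nil_shuffles a b : ([::] \in shuffles a b) = nilp a && nilp b.
Proof.
case: a b => [|z a] [|y b] //=; rewrite mem_cat.
by apply/norP; split; apply/mapP => -[].
Qed.

Lemma shuffles_perm a b s : s \in shuffles a b -> perm_eq s (a ++ b).
Proof.
elim: s a b => [|z s IHs] a b.
  by rewrite nil_shuffles => /andP[/nilP-> /nilP->].
rewrite mem_shuffles_cons => /orP[].
  by case: a => [|y a] //= /andP[/eqP[->] /IHs]; rewrite perm_cons.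
case: b => [|y b] //= /andP[/eqP[->] /IHs];
  rewrite -(perm_cons z) => /perm_trans-> //.
by rewrite -cat1s -[_ :: b]cat1s perm_catCA.
Qed.

Lemma uniq_shuffles a b : uniq (a ++ b) -> uniq (shuffles a b).
Proof.
elim: a b => [//|z a IHa]; elim=> [//|y b IHb] Uab;
  rewrite shuffles_cons2 cat_uniq.
have /= /andP[zab Uab'] := Uab.
have Uzab : uniq (z :: a ++ b).
  by apply: subseq_uniq Uab => /=; rewrite eqxx cat_subseq ?subseq_cons.
have cons_inj q : injective (cons q : seq V -> seq V) by move=> ? ? [].
rewrite !(map_inj_uniq (cons_inj _)) IHa ?IHb // andbT.
apply/hasPn => _ /mapP[s _ ->]; rewrite mem_map_cons; apply/nandP; left.
by apply: contraNneq zab => <-; rewrite mem_cat mem_head orbT.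
Qed.

Lemma sum_shuffles_cons (R : nmodType) (r z : V) a b (f : seq V -> R) :
    head r a \notin b ->
  \sum_(s <- shuffles (z :: a) b) f s =
    \sum_(s <- shuffles a b)
      \sum_(0 <= i < (index (head r a) (rcons s r)).+1) f (insert i [:: z] s).
Proof.
pose ins q (g : seq V -> R) s :=
  \sum_(0 <= i < (index q (rcons s r)).+1) g (insert i [:: z] s).
have insE q g y s :
    y != q -> ins q g (y :: s) = g [:: z, y & s] + ins q (g \o cons y) s.
  by move=> /negPf yq; rewrite /ins rcons_cons /= yq big_nat_recl.
have ins_head q g s : ins q g (q :: s) = g [:: z, q & s].
  by rewrite /ins rcons_cons /= eqxx big_nat1.
elim: b f => [|y b IHb] f.
  case: a => [|u a] _; rewrite !big_seq1 -/(ins _ f _) ?ins_head //.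
  by rewrite /ins /= eqxx big_nat1.
rewrite inE negb_or eq_sym => /andP[yq qb].
rewrite shuffles_cons2 big_cat !big_map /= (IHb (f \o cons y)) //.
rewrite -[RHS]/(\sum_(s <- _) ins (head r a) f s).
case: a yq {IHb qb} => [|u a] yq; first by rewrite !big_seq1 insE.
rewrite shuffles_cons2 !big_cat !big_map -addrA -big_split; congr (_ + _).
  by apply: eq_bigr => s _; rewrite ins_head.
by apply: eq_bigr => s _; rewrite insE.
Qed.

Lemma sum_word_prod_shuffles (F : fieldType) (x : V -> F) (r : V) a b :
    injective x -> uniq (r :: a ++ b) ->
  \sum_(s <- shuffles a b) word_prod x (rcons s r) =
    word_prod x (rcons a r) * word_prod x (rcons b r).
Proof.
move=> x_inj; elim: a => [|z a IHa].
  by rewrite /= big_seq1 word_prod1 mul1r.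
rewrite /= inE negb_or => /and3P[/andP[rz rab] zab Uab].
have Urab : uniq (r :: a ++ b) by rewrite /= rab.
have zrab : z \notin r :: a ++ b by rewrite inE negb_or eq_sym rz.
have head_ar : head r a \in rcons a r.
  by case: (a) => [|u a'] /=; rewrite mem_head.
have qb : head r a \notin b.
  move: Urab; rewrite -cat_cons cat_uniq => /and3P[_ /hasPn disj _].
  by apply: contraL head_ar => /disj; rewrite mem_rcons.
rewrite (sum_shuffles_cons z _ qb) (_ : word_prod x (rcons (z :: a) r) =
    (x z - x (head r a))^-1 * word_prod x (rcons a r)); last first.
  by case: (a) => [|u a'] /=; rewrite word_prod_cons2.
rewrite -mulrA -IHa // big_distrr /=; apply: eq_big_seq => s /shuffles_perm sab.
have rsab : perm_eq (rcons s r) (r :: a ++ b) by rewrite perm_rcons perm_cons.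
rewrite -sum_word_prod_insert ?(perm_uniq rsab) ?(perm_mem rsab) //; last first.
  by rewrite -cat_cons mem_cat -mem_rcons head_ar.
apply: eq_big_nat => i /andP[_]; rewrite ltnS => iq; rewrite rcons_insert //.
apply: leq_trans iq (index_rcons_leq _).
by rewrite (perm_mem rsab) -cat_cons mem_cat -mem_rcons head_ar.
Qed.

Section Spread.
Variable r : V.
Implicit Types (w : seq V).

Fixpoint spread s : seq (seq V) :=
  if s is z :: s' then map (cons z) (spread s') ++ map (rcons^~ z) (spread s')
  else [:: [:: r]].

Lemma spread_perm s w : w \in spread s -> perm_eq w (rcons s r).
Proof.
elim: s w => [|z s IHs] w; first by rewrite inE => /eqP->.
rewrite mem_cat => /orP[] /mapP[w' /IHs w's ->];
  last by rewrite perm_rcons perm_cons.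
by rewrite perm_cons.
Qed.

Lemma spread_root s w : w \in spread s -> r \in w.
Proof. by move/spread_perm/perm_mem->; rewrite mem_rcons mem_head. Qed.

Lemma uniq_spread s : uniq (rcons s r) -> uniq (spread s).
Proof.
elim: s => //= z s IHs /andP[zs Us].
rewrite cat_uniq !map_inj_uniq ?IHs //=; last first.
- by move=> w w' [].
- exact: rcons_injl.
rewrite andbT; apply/hasPn => _ /mapP[w ws ->]; apply/mapP=> -[w' _].
case: w ws => [/spread_root //|a w] ws [az _]; case/negP: zs.
by rewrite -(perm_mem (spread_perm ws)) -az mem_head.
Qed.

Lemma mem_spread a b s : r \notin a -> r \notin b ->
  (a ++ r :: rev b \in spread s) = (s \in shuffles a b).
Proof.
elim: s a b => [|z s IHs] a b ra rb.
  rewrite nil_shuffles inE; case: a ra => [|y a] //=; last first.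
    by rewrite inE negb_or eqseq_cons eq_sym => /andP[/negPf->].
  by rewrite eqseq_cons eqxx -size_eq0 size_rev.
rewrite mem_shuffles_cons mem_cat; congr (_ || _).
  case: a ra => [|y a] /=; last first.
    by rewrite inE negb_or mem_map_cons => /andP[_ ra]; rewrite IHs.
  rewrite mem_map_cons => _; apply/negP => /andP[_ /spread_root].
  by rewrite mem_rev (negPf rb).
case: b rb => [|y b] /=; last first.
  rewrite inE negb_or => /andP[_ rb];
    rewrite -IHs // rev_cons -rcons_cons -rcons_cat.
  apply/mapP/andP => [[w ws /rcons_inj[-> ->]] | [/eqP[->] ws]];
    first by rewrite eqxx.
  by exists (a ++ r :: rev b).
move=> _; apply/mapP => -[w ws]; rewrite cats1 => /rcons_inj[def_a _].
by rewrite def_a (spread_root ws) in ra.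
Qed.

Definition before w := take (index r w) w.
Definition after w := drop (index r w).+1 w.

Lemma cat_before_after w : r \in w -> before w ++ r :: after w = w.
Proof. by move=> rw; rewrite /before /after -drop_index // cat_take_drop. Qed.

Lemma after_cons z w : z != r -> after (z :: w) = after w.
Proof. by rewrite /after /= => /negPf->. Qed.

Lemma after_rcons z w : r \in w -> after (rcons w z) = rcons (after w) z.
Proof.
by move=> rw; rewrite /after -cats1 index_cat rw cats1 drop_rcons // index_mem.
Qed.

(* The orders in which [w] is spelled from [r] outwards, most recent first. *)
Definition spread_orders w := shuffles (before w) (rev (after w)).

Lemma before_after_uniq w : uniq w -> r \in w ->
  uniq (r :: before w ++ rev (after w)).
Proof.
move=> Uw rw; rewrite -cat1s uniq_catCA.
rewrite (perm_uniq (_ : perm_eq _ w)) //=.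
rewrite -[w in perm_eq _ w]cat_before_after //.
by rewrite perm_cat2l perm_cons perm_rev.
Qed.

Lemma mem_spread_orders w s : uniq w -> r \in w ->
  (s \in spread_orders w) = (w \in spread s).
Proof.
move=> Uw rw; have := before_after_uniq Uw rw.
rewrite /= mem_cat negb_or => /andP[/andP[ra rb] _].
by rewrite -mem_spread // revK cat_before_after.
Qed.

Lemma uniq_spread_orders w : uniq w -> r \in w -> uniq (spread_orders w).
Proof.
by move=> Uw rw; have /andP[_ /uniq_shuffles] := before_after_uniq Uw rw.
Qed.

Lemma word_prod_spread_orders (F : fieldType) (x : V -> F) w :
    injective x -> uniq w -> r \in w ->
  word_prod x w = (-1) ^+ size (after w) *
    \sum_(s <- spread_orders w) word_prod x (rcons s r).
Proof.
move=> x_inj Uw rw; rewrite sum_word_prod_shuffles ?before_after_uniq //.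
rewrite mulrCA -{1}(cat_before_after rw) word_prod_cat; congr (_ * _).
by rewrite -rev_cons word_prod_rev /= mulrA -expr2 sqrr_sign mul1r.
Qed.

End Spread.

End Shuffles.

(** * Spanning trees *)

Lemma uniq_map_inj_in (A B : eqType) (f : A -> B) (s : seq A) :
  uniq (map f s) -> {in s &, injective f}.
Proof.
elim: s => //= a s IHs /andP[fa Us] b b' /predU1P[->|bs] /predU1P[->|b's] //.
- by move=> fb; rewrite fb map_f in fa.
- by move=> fb; rewrite -fb map_f in fa.
exact: IHs.
Qed.

Lemma path_exits (A : Type) (e : rel A) (P : pred A) a s :
    path e a s -> P a -> ~~ P (last a s) ->
  exists b b', [/\ e b b', P b & ~~ P b'].
Proof.
elim: s a => [|b s IHs] a /=; first by move=> _ ->.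
case/andP=> ab ps Pa; have [/(IHs b ps)|Pb _] := boolP (P b); first by apply.
by exists a, b.
Qed.

Definition opp_vertex (G : digraph) (d : dart G) : vertex G :=
  dart_vertex (opp_dart d).

Notation dart_reached := (reached (@dart_vertex _)).
Notation dart_growth := (growth (@dart_vertex _) (@opp_vertex _)).

Section Darts.
Variable G : digraph.
Implicit Types (d : dart G) (c q : seq (dart G)) (u v z : vertex G).
Implicit Types (w : seq (vertex G)) (T : {set edge G}).

Lemma opp_dartK : involutive (@opp_dart G).
Proof. by case=> e b; rewrite /opp_dart /= negbK. Qed.

Lemma opp_dart_inj : injective (@opp_dart G).
Proof. exact: inv_inj opp_dartK. Qed.

Lemma opp_vertexK d : opp_vertex (opp_dart d) = dart_vertex d.
Proof. by rewrite /opp_vertex opp_dartK. Qed.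

Lemma dart_ends (P : pred (vertex G)) d :
  P (origin d.1) && P (target d.1) = P (dart_vertex d) && P (opp_vertex d).
Proof. by case: d => e [] //=; rewrite andbC. Qed.

Lemma opp_dart_neq d : opp_dart d != d.
Proof. by case: d => e []; rewrite xpair_eqE andbF. Qed.

Lemma eq_edge_dart d d' : d.1 = d'.1 -> d = d' \/ d = opp_dart d'.
Proof.
case: d d' => e b [e' b'] /= ->.
by case: b b' => [] []; rewrite /opp_dart; auto.
Qed.

Definition loopless := forall e : edge G, origin e != target e.

Definition edges_within w : pred (edge G) :=
  [pred e | (origin e \in w) && (target e \in w)].

Definition facing w z : pred (dart G) :=
  [pred d | (dart_vertex d == z) && (opp_vertex d \in w)].

Lemma forall_edges_within1 (P : pred (edge G)) z :
  loopless -> [forall (e | edges_within [:: z] e), P e].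
Proof.
move=> loopless_G; apply/forall_inP => e /andP[].
rewrite !mem_seq1 => /eqP oe /eqP te; have := loopless_G e.
by rewrite oe te eqxx.
Qed.

Lemma forall_edges_within_cons (P : pred (edge G)) z w :
    loopless -> z \notin w ->
  [forall (e | edges_within (z :: w) e), P e] =
    [forall (d | facing w z d), P d.1] && [forall (e | edges_within w e), P e].
Proof.
move=> loopless_G zw; apply/forall_inP/andP; last first.
  case=> /forall_inP Pz /forall_inP Pw e; rewrite /edges_within /= !inE.
  case/andP=> /predU1P[oe|oe] /predU1P[te|te].
  - by have := loopless_G e; rewrite oe te eqxx.
  - by apply: (Pz (e, false)); rewrite /facing /dart_vertex /= oe eqxx.
  - by apply: (Pz (e, true)); rewrite /facing /dart_vertex /= te eqxx.
  by apply: Pw; rewrite /edges_within /= oe.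
move=> Pzw; split; apply/forall_inP.
  move=> d /andP[/eqP dz od]; apply: Pzw; rewrite /edges_within /=.
  by rewrite (dart_ends (fun v => v \in z :: w)) dz mem_head inE od orbT.
move=> e /andP[oe te]; apply: Pzw.
by rewrite /edges_within /= !inE oe te !orbT.
Qed.

Lemma adjacentP T u v : reflect
  (exists d, [/\ d.1 \in T, dart_vertex d = u & opp_vertex d = v])
  (adjacent T u v).
Proof.
apply: (iffP existsP) => -[d]; first by case/and3P=> dT /eqP du /eqP; exists d.
by case=> dT du dv; exists d; rewrite dT du -dv !eqxx.
Qed.

Lemma adjacent_sym T u v : adjacent T u v = adjacent T v u.
Proof.
apply/adjacentP/adjacentP => -[d [dT du dv]];
  by exists (opp_dart d); rewrite opp_vertexK.
Qed.

Lemma acyclic_loopless T e : acyclic T -> e \in T -> origin e != target e.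
Proof.
move=> /acyclicP acyc eT; apply/eqP => oe; have /negP[] := acyc [:: (e, false)].
by rewrite /is_cycle /= eT /dart_vertex /= oe eqxx.
Qed.

Lemma cycle_avoids_leaf T d c :
    (forall y, y.1 \in T -> dart_vertex y = dart_vertex d -> y = d) ->
  is_cycle T c -> d.1 \notin map fst c.
Proof.
move=> leaf /and5P[_ cT cyc Uc _].
have cd : d \notin c.
  apply/negP => dc; set z := prev c d.
  have /eqP end_z : opp_vertex z == dart_vertex d by apply: prev_cycle cyc dc.
  have zc : z \in c by rewrite mem_prev.
  have oz : opp_dart z = d by apply: leaf end_z; apply: (allP cT z zc).
  have zd : z = d by apply: (uniq_map_inj_in Uc zc dc); rewrite -[in RHS]oz.
  by have := opp_dart_neq d; rewrite -{1}zd oz eqxx.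
apply/mapP => -[y yc] /esym/eq_edge_dart[] def_y.
  by rewrite -def_y yc in cd.
have := next_cycle cyc yc; rewrite {1}def_y opp_dartK => /eqP/esym end_y.
have yc' : next c y \in c by rewrite mem_next.
by rewrite -(leaf _ (allP cT _ yc') end_y) yc' in cd.
Qed.

Lemma is_cycleD1 T e c :
  is_cycle (e |: T) c -> e \notin map fst c -> is_cycle T c.
Proof.
case/and5P=> c0 cT cyc Uc Uv ec; apply/and5P; split=> //; apply/allP => d dc.
have := allP cT d dc; rewrite !inE => /predU1P[de | //].
by rewrite -de map_f in ec.
Qed.

Definition dart_walk u s q :=
  map (@dart_vertex G) q = belast u s /\ map (@opp_vertex G) q = s.

Lemma adjacent_path_walk T u s : path (adjacent T) u s ->
  exists2 q, dart_walk u s q & {in q, forall d, d.1 \in T}.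
Proof.
elim: s u => [|v s IHs] u /=; first by exists [::].
case/andP=> /adjacentP[d [dT du dv]] /IHs[q [tq bq] qT].
exists (d :: q); first by rewrite /dart_walk /= du dv tq bq.
by move=> y; rewrite inE => /predU1P[-> // | /qT].
Qed.

Lemma dart_walk_uniq u s q :
  uniq (u :: s) -> dart_walk u s q -> uniq (map fst q).
Proof.
elim: q u s => [//|d q IHq] u [_ [] //|v s] /= /andP[us Us] [] [du tq] [dv bq].
rewrite (IHq v s) ?andbT //.
apply: contra us => /mapP[y yq /eq_edge_dart[]] def_d.
  by rewrite -du def_d; apply: (@mem_belast _ s v); rewrite -tq map_f.
by rewrite -du def_d -/(opp_vertex y) inE -bq map_f ?orbT.
Qed.

Lemma dart_walk_path d s q : dart_walk (opp_vertex d) s q ->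
  path (fun d d' => dart_vertex (opp_dart d) == dart_vertex d') d q.
Proof.
elim: q d s => [//|y q IHq] d [[] //|v s] [] /= [yd tq] [yv bq].
by rewrite yd eqxx (IHq y s) //; split; rewrite // yv.
Qed.

Lemma dart_walk_last d s q :
  dart_walk (opp_vertex d) s q -> opp_vertex (last d q) = last (opp_vertex d) s.
Proof. by case=> _ <-; rewrite last_map. Qed.

Lemma connected_sub_acyclic T T' :
  connected_by T' -> T' \subset T -> acyclic T -> T' = T.
Proof.
move=> conn sub acycT; apply/eqP; rewrite eqEsubset sub /=.
apply/subsetP => e eT; apply: contraT => eT'.
have /connectP[s0 ps0 def_o] := forallP (forallP conn (target e)) (origin e).
case/shortenP: ps0 def_o => s ps Us _ def_o.
have [q walk_q qT'] := adjacent_path_walk ps.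
have /acyclicP/(_ ((e, false) :: q))/negP[] := acycT; apply/and5P; split=> //=.
- by rewrite eT; apply/allP => d /qT'; apply: (subsetP sub).
- rewrite rcons_path (@dart_walk_path (e, false) s) //=.
  by rewrite -/(opp_vertex _) (@dart_walk_last (e, false) s) //= -def_o.
- rewrite (dart_walk_uniq Us walk_q) andbT.
  by apply: contra eT' => /mapP[d /qT' dT' ->].
have [-> _] := walk_q; rewrite [dart_vertex (e, _)]def_o -rcons_uniq -lastI.
exact: Us.
Qed.

End Darts.

Section TreeGrowth.
Variables (G : digraph) (r : vertex G).
Implicit Types (d : dart G) (t : seq (dart G)) (T : {set edge G}).

Definition spans t := forall v, v \in dart_reached r t.

Definition tree_of t : {set edge G} := [set e in map fst t].

Lemma mem_tree_of t d : (d.1 \in tree_of t) = (d \in t) || (opp_dart d \in t).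
Proof.
rewrite inE; apply/mapP/orP => [[d' d't] /eq_edge_dart[->|->] | [] dt].
- by left.
- by right; rewrite opp_dartK.
- by exists d.
by exists (opp_dart d).
Qed.

Lemma tree_of_cons d t : tree_of (d :: t) = d.1 |: tree_of t.
Proof. by apply/setP => e; rewrite !inE. Qed.

Lemma perm_tree_of t t' : perm_eq t t' -> tree_of t = tree_of t'.
Proof.
by move=> tt'; apply/setP => e; rewrite !inE (perm_mem (perm_map _ tt')).
Qed.

Lemma growth_tree_reached t d :
  dart_growth r t -> d.1 \in tree_of t -> dart_vertex d \in dart_reached r t.
Proof.
move=> gt; rewrite mem_tree_of.
case/orP=> [/child_reached-> // | /(growth_parent gt)].
by rewrite opp_vertexK.
Qed.

Lemma growth_new_edge d t :
    dart_growth r t -> dart_vertex d \notin dart_reached r t ->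
  d.1 \notin tree_of t.
Proof. by move=> gt; apply: contra; apply: growth_tree_reached. Qed.

Lemma growth_edges_uniq t : dart_growth r t -> uniq (map fst t).
Proof.
elim: t => // d t IHt /growth_consP[dt _ gt] /=; rewrite IHt // andbT.
by have := growth_new_edge gt dt; rewrite inE.
Qed.

Lemma growth_connect t T v : dart_growth r t -> tree_of t \subset T ->
  v \in dart_reached r t -> connect (adjacent T) r v.
Proof.
elim: t v => [|d t IHt] v; first by rewrite inE => _ _ /eqP->.
case/growth_consP=> _ pd gt.
rewrite tree_of_cons subUset sub1set => /andP[dT tT].
rewrite inE => /predU1P[->|]; last exact: IHt.
apply: connect_trans (IHt _ gt tT pd) (connect1 _).
by rewrite adjacent_sym; apply/adjacentP; exists d.
Qed.

Lemma growth_connected t :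
  dart_growth r t -> spans t -> connected_by (tree_of t).
Proof.
move=> gt full; apply/forallP => u; apply/forallP => v.
apply: (@connect_trans _ _ r).
  by rewrite (sym_connect_sym (@adjacent_sym _ _)) (growth_connect gt).
exact: growth_connect gt _ _.
Qed.

Lemma growth_acyclic t : dart_growth r t -> acyclic (tree_of t).
Proof.
elim: t => [_|d t IHt /growth_consP[dt pd gt]].
  by apply/acyclicP => -[|a c] //; rewrite /is_cycle /= inE.
apply/acyclicP => c; apply/negP; rewrite tree_of_cons => cyc.
have /acyclicP/(_ c)/negP[] := IHt gt; apply: is_cycleD1 (cyc) _.
apply: cycle_avoids_leaf cyc => y; rewrite in_setU1.
case/predU1P=> [/eq_edge_dart[]// def_y | yT] yd; case/negP: dt; rewrite -yd.
  by rewrite def_y.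
exact: growth_tree_reached.
Qed.

Lemma growth_spanning_tree t :
  dart_growth r t -> spans t -> spanning_tree (tree_of t).
Proof.
by move=> gt full; rewrite /spanning_tree growth_connected ?growth_acyclic.
Qed.

(* The edges of a growth all point away from the root, so that the tree
   determines their darts. *)
Lemma growth_tree_sub t t' : dart_growth r t -> dart_growth r t' ->
  tree_of t \subset tree_of t' -> {subset t <= t'}.
Proof.
move=> gt gt'; elim: t gt => [//|d t IHt] /growth_consP[dt pd gt].
rewrite tree_of_cons subUset sub1set => /andP[dT /(IHt gt) sub].
move=> y; rewrite inE => /predU1P[-> {y}|]; last exact: sub.
have /= := growth_uniq gt'; rewrite rcons_uniq => /andP[r't' Ut'].
move: dT; rewrite mem_tree_of => /orP[// | odt'].
have /negP[] := growth_new_edge gt dt; move: pd; rewrite mem_reached.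
case/predU1P=> [pd|/mapP[y yt py]].
  by rewrite -pd -[opp_vertex d]/(dart_vertex (opp_dart d)) map_f in r't'.
rewrite mem_tree_of (_ : opp_dart d = y) ?yt ?orbT //.
exact: uniq_map_inj_in Ut' _ _ odt' (sub _ yt) py.
Qed.

Lemma growth_tree_perm t t' : dart_growth r t -> dart_growth r t' ->
  tree_of t = tree_of t' -> perm_eq t t'.
Proof.
move=> gt gt' eqT; apply: uniq_perm => [||d].
- exact: map_uniq (growth_edges_uniq gt).
- exact: map_uniq (growth_edges_uniq gt').
by apply/idP/idP; apply: growth_tree_sub; rewrite // eqT.
Qed.

Lemma growth_extend t T v : connected_by T -> dart_growth r t ->
  v \notin dart_reached r t -> exists2 d, d.1 \in T & dart_growth r (d :: t).
Proof.
move=> conn gt; have /connectP[s ps ->] := forallP (forallP conn r) v.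
have exits := @path_exits _ _ [pred v | v \in dart_reached r t] _ _ ps.
case/exits => [|u [a [/adjacentP[d [dT du da]] /= ut at']]].
  exact: root_reached.
by exists (opp_dart d); rewrite //= opp_vertexK du ut -/(opp_vertex d) da at'.
Qed.

Lemma growth_exists T : spanning_tree T -> exists t,
  [/\ dart_growth r t, spans t & tree_of t = T].
Proof.
case/andP=> conn acyc.
suff [t [gt full sub]] : exists t,
    [/\ dart_growth r t, spans t & tree_of t \subset T].
  by exists t; split=> //; apply: connected_sub_acyclic => //;
    apply: growth_connected.
have [n] := ubnP #|[predC dart_reached r [::]]|.
have : dart_growth r [::] && (tree_of [::] \subset T).
  by apply/subsetP => e; rewrite inE.
elim: n [::] => // n IHn t /andP[gt tT]; rewrite ltnS => le_n.
have [v vt|full] := pickP [predC dart_reached r t]; last first.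
  by exists t; split=> // v; have /= /negbFE := full v.
have [d dT gdt] := growth_extend conn gt vt.
apply: (IHn (d :: t)); first by rewrite gdt tree_of_cons subUset sub1set dT.
apply: leq_trans le_n; apply: proper_card; apply/properP; split.
  by apply/subsetP => u; rewrite !inE negb_or => /andP[].
by exists (dart_vertex d); rewrite !inE ?eqxx //; case/growth_consP: gdt.
Qed.

End TreeGrowth.

(** * The tour of a growing tree *)

Section Orbits.
Variable A : finType.
Implicit Types (f g : A -> A) (a b c : A) (s t : seq A).

Lemma orbit_cons f a : exists s, orbit f a = a :: s.
Proof. by rewrite /orbit -orderSpred; eexists. Qed.

Lemma orbit_fcycle f a s :
  fcycle f (a :: s) -> uniq (a :: s) -> orbit f a = a :: s.
Proof. by move=> fs Us; rewrite (orbitE fs Us) ?mem_head //= eqxx rot0. Qed.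

Lemma eq_in_orbit f g a :
  injective f -> {in orbit f a, f =1 g} -> orbit g a = orbit f a.
Proof.
move=> f_inj fg; have [s def_s] := orbit_cons f a; rewrite def_s in fg *.
apply: orbit_fcycle; rewrite -def_s ?orbit_uniq //.
have := cycle_orbit f_inj a; apply: (@sub_in_cycle _ (mem (orbit f a)));
  last exact: allss.
by move=> b c; rewrite def_s => /fg /= ->.
Qed.

Lemma fpath_tperm f b c a s : b \notin s -> c \notin s ->
  fpath (tperm b c \o f) a s = fpath f a s.
Proof.
elim: s a => //= z s IHs a; rewrite !inE !negb_or => /andP[bz bs] /andP[cz cs].
by rewrite IHs // -{1}(tpermD bz cz) (inj_eq perm_inj).
Qed.

Lemma fcycle_tperm_merge f b s c t :
    fcycle f (b :: s) -> fcycle f (c :: t) -> uniq ((c :: t) ++ b :: s) ->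
  fcycle (tperm b c \o f) ((c :: t) ++ b :: s).
Proof.
rewrite cat_uniq /= !rcons_path cat_path last_cat /=.
move=> /andP[ps /eqP ls] /andP[pt /eqP lt] /and3P[/andP[ct _] disj /andP[bs _]].
move: disj; rewrite !inE !negb_or => /andP[/andP[bc bt] /hasPn disj].
have cs : c \notin s by apply/negP => /disj; rewrite mem_head.
by rewrite !fpath_tperm // pt ps /= lt ls tpermL tpermR !eqxx.
Qed.

Lemma orbit_tperm_merge f a b c :
    injective f -> a != b -> b \in orbit f a -> c \notin orbit f a ->
  orbit (tperm b c \o f) a =
    insert (index b (orbit f a)) (orbit f c) (orbit f a).
Proof.
move=> f_inj ab b_a c_a; have := cycle_orbit f_inj a; have := orbit_uniq f a.
have disj : ~~ has (mem (orbit f a)) (orbit f c).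
  apply/hasPn => y; rewrite -fconnect_orbit => cy; apply: contra c_a => /= ay.
  by rewrite -!fconnect_orbit in ay *;
    rewrite (connect_trans ay) // fconnect_sym.
have [s def_s] := orbit_cons f a; have [t def_t] := orbit_cons f c.
have ct := cycle_orbit f_inj c; have Ut := orbit_uniq f c.
case/splitPr: b_a def_s disj => s1 s2; case: s1 => [[ba]|a' s1 [-> _] disj Us].
  by rewrite ba eqxx in ab.
have b1 : b \notin a :: s1.
  by move: Us; rewrite uniq_catC /= mem_cat negb_or => /andP[/andP[]].
rewrite index_pivot // /insert take_size_cat // drop_size_cat //.
rewrite cycle_catC => cs.
have Uts : uniq (orbit f c ++ (a :: s1) ++ b :: s2).
  by rewrite cat_uniq Ut has_sym disj.
rewrite def_t in ct Uts *.
rewrite (cat_cons a); apply: orbit_fcycle; last first.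
  by rewrite -(cat_cons a) uniq_catCA.
rewrite -(cat_cons a) cycle_catC -catA; apply: fcycle_tperm_merge => //.
rewrite -(cat_cons b) -(@perm_uniq _ ((c :: t) ++ (a :: s1) ++ b :: s2)) //.
by rewrite perm_cat2l perm_catC.
Qed.

End Orbits.

Section Precedes.
Variable A : eqType.
Implicit Types (a b : A) (i : nat) (m s : seq A) (P : pred A).

Definition precedes s a b := (index a s < index b s)%N.

Lemma precedes_insert_old i m s a b :
    a \in s -> b \in s -> a \notin m -> b \notin m -> (i <= size s)%N ->
  precedes (insert i m s) a b = precedes s a b.
Proof.
move=> a_s b_s am bm si; rewrite /precedes !index_insert_old //.
by case: (ltnP (index a s) i); case: (ltnP (index b s) i); lia.
Qed.

Lemma precedes_insert_new i m s a b :
    a \in s -> a \notin m -> b \in m -> b \notin s -> (i <= size s)%N ->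
  precedes (insert i m s) a b = (index a s < i)%N /\
  precedes (insert i m s) b a = ~~ (index a s < i)%N.
Proof.
move=> a_s am bm b_s si; have := index_insert_new bm b_s si.
rewrite /precedes (index_insert_old a_s am si).
by case: (ltnP (index a s) i); lia.
Qed.

Lemma precedes_filter P s a b : P a -> P b ->
  precedes (filter P s) a b = precedes s a b.
Proof.
rewrite /precedes => Pa Pb; elim: s => //= y s IHs; case: ifPn => /= Py.
  by case: (y == a); case: (y == b).
have yF y' : P y' -> (y == y') = false.
  by move=> Py'; apply: contraNF Py => /eqP->.
by rewrite !yF.
Qed.

End Precedes.

Lemma precedes_map (A B : eqType) (f : A -> B) s a b :
  injective f -> precedes (map f s) (f a) (f b) = precedes s a b.
Proof. by move=> f_inj; rewrite /precedes !index_map. Qed.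

Section TourGrowth.
Variables (G : digraph) (M : rooted_map G).
Implicit Types (d y : dart G) (t : seq (dart G)) (T : {set edge G}).
Implicit Types (h : xdart G).

Notation r := (Defs.root M).
Notation tour_orbit t := (orbit (tour_step M (tree_of t)) None).

Definition contour t : seq (dart G) := pmap id (tour_orbit t).

Definition darts_around d : seq (dart G) :=
  pmap id (orbit (rotation M) (Some d)).

Lemma mem_orbit_rotation h h' :
  (h' \in orbit (rotation M) h) = (xdart_vertex r h' == xdart_vertex r h).
Proof.
have := rotation_orbits M h => /setP/(_ h'); rewrite inE => <-.
rewrite -fconnect_orbit; apply/idP/porbitP => [/iter_findex <-|[i ->]].
  by exists (findex (rotation M) h h'); rewrite permX.
by rewrite permX fconnect_iter.
Qed.

Lemma mem_darts_around d y :
  (y \in darts_around d) = (dart_vertex y == dart_vertex d).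
Proof. by rewrite mem_pmap map_id mem_orbit_rotation. Qed.

Lemma tour_step_setU1 d T : d.1 \notin T ->
  tour_step M (d.1 |: T) =1 tperm (Some (opp_dart d)) (Some d) \o tour_step M T.
Proof.
move=> dT h; rewrite /tour_step /=; case: (rotation M h) => [y|] /=;
  last by rewrite tpermD.
rewrite in_setU1; case: eqP => [yd | yd] /=; last first.
  by case: ifP => _; rewrite tpermD //;
    apply/eqP => /Some_inj/(congr1 fst)/esym.
rewrite yd (negPf dT); case: (eq_edge_dart yd) => ->; first by rewrite tpermR.
by rewrite opp_dartK tpermL.
Qed.

Lemma orbit_tour_step_new t d :
    dart_growth r t -> dart_vertex d \notin dart_reached r t ->
  orbit (tour_step M (tree_of t)) (Some d) = orbit (rotation M) (Some d).
Proof.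
move=> gt dt; apply: eq_in_orbit => [|h hd]; first exact: perm_inj.
have := mem_orbit hd; rewrite mem_orbit_rotation /tour_step.
case: (rotation M h) => //= y /eqP yd.
by rewrite (negPf (growth_new_edge gt _)) // yd.
Qed.

Lemma tour_orbit_cons d t : dart_growth r (d :: t) ->
    Some (opp_dart d) \in tour_orbit t -> Some d \notin tour_orbit t ->
  tour_orbit (d :: t) = insert (index (Some (opp_dart d)) (tour_orbit t))
    (orbit (rotation M) (Some d)) (tour_orbit t).
Proof.
case/growth_consP=> dt _ gt od_t d_t; rewrite -(orbit_tour_step_new gt dt).
rewrite -orbit_tperm_merge //; last exact: tour_step_inj.
rewrite tree_of_cons; apply: eq_in_orbit => [|h _ /=].
  exact: inj_comp perm_inj (@tour_step_inj _ _ _).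
by rewrite tour_step_setU1 ?(growth_new_edge gt).
Qed.

Lemma mem_tour_orbit t h : dart_growth r t ->
  (h \in tour_orbit t) = (xdart_vertex r h \in dart_reached r t).
Proof.
elim: t h => [h _|d t IHt h gdt].
  rewrite (@eq_in_orbit _ (rotation M)) ?mem_orbit_rotation ?inE //;
    first exact: perm_inj.
  by move=> h' _; rewrite /tour_step; case: (rotation M h') => //= y;
    rewrite inE.
have [dt pd gt] := growth_consP gdt.
rewrite tour_orbit_cons ?IHt // (perm_mem (perm_insert _ _ _)) mem_cat.
by rewrite mem_orbit_rotation IHt // inE.
Qed.

Lemma mem_contour t d : dart_growth r t ->
  (d \in contour t) = (dart_vertex d \in dart_reached r t).
Proof. by move=> gt; rewrite mem_pmap map_id mem_tour_orbit. Qed.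

Lemma contour_uniq t : uniq (contour t).
Proof. by apply: (@pmap_uniq _ _ _ Some) => [[]|] //; apply: orbit_uniq. Qed.

Lemma contour_cons d t : dart_growth r (d :: t) ->
  contour (d :: t) =
    insert (index (opp_dart d) (contour t)) (darts_around d) (contour t).
Proof.
move=> gdt; have [dt pd gt] := growth_consP gdt.
by rewrite /contour tour_orbit_cons ?mem_tour_orbit // pmap_id_insert.
Qed.

Definition ordered t (e : edge G) : bool :=
  precedes (contour t) (e, false) (e, true).

Lemma ordered_cons_old d t e :
    dart_growth r (d :: t) -> origin e \in dart_reached r t ->
    target e \in dart_reached r t ->
  ordered (d :: t) e = ordered t e.
Proof.
move=> gdt oe te; have [dt _ gt] := growth_consP gdt.
rewrite /ordered contour_cons //.
rewrite precedes_insert_old ?index_size ?mem_contour //.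
  by rewrite mem_darts_around; apply: contraNneq dt => <-.
by rewrite mem_darts_around; apply: contraNneq dt => <-.
Qed.

Lemma ordered_cons_new d t y :
    dart_growth r (d :: t) -> dart_vertex y = dart_vertex d ->
    opp_vertex y \in dart_reached r t ->
  ordered (d :: t) y.1 =
    (precedes (contour t) (opp_dart y) (opp_dart d) == y.2).
Proof.
move=> gdt yd oy; have [dt _ gt] := growth_consP gdt.
rewrite /ordered contour_cons //.
have oy_d : opp_dart y \notin darts_around d.
  by rewrite mem_darts_around; apply: contraNneq dt => <-.
have y_d : y \in darts_around d by rewrite mem_darts_around yd.
have oy_t : opp_dart y \in contour t by rewrite mem_contour.
have y_t : y \notin contour t by rewrite mem_contour // yd.
have := precedes_insert_new oy_t oy_d y_d y_t (index_size (opp_dart d) _).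
by case: y {yd oy oy_d y_d oy_t y_t} => e [] /= [old_new new_old];
  rewrite ?eqb_id ?eqbF_neg.
Qed.

(* When [d] is attached, the edges from its vertex to the reached ones become
   ordered by the contour iff those met before [d] enter the new vertex and
   those met after it leave. *)
Definition good_step t d : bool :=
  [forall (y | facing (dart_reached r t) (dart_vertex d) y),
    (y != d) ==> (precedes (contour t) (opp_dart y) (opp_dart d) == y.2)].

Fixpoint good_growth t : bool :=
  if t is d :: t' then good_step t' d && good_growth t' else true.

Definition well_ordered t : bool :=
  [forall (e | edges_within (dart_reached r t) e),
    (e \notin tree_of t) ==> ordered t e].

Hypothesis loopless_G : loopless G.

Lemma well_ordered_cons d t : dart_growth r (d :: t) ->
  well_ordered (d :: t) = good_step t d && well_ordered t.
Proof.
move=> gdt; have [dt pd gt] := growth_consP gdt.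
rewrite /well_ordered [LHS](forall_edges_within_cons _ loopless_G dt).
have edge_d y : y.1 = d.1 -> y = d \/ dart_vertex y \in dart_reached r t.
  by case/eq_edge_dart=> ->; [left | right].
congr (_ && _).
  apply: eq_forallb_in => y /andP[/eqP yd oy].
  rewrite ordered_cons_new // tree_of_cons in_setU1 negb_or.
  rewrite (growth_new_edge gt) ?yd // andbT; congr (~~ _ ==> _);
    apply/eqP/eqP => [/edge_d[]// | -> //].
  by rewrite yd (negPf dt).
apply: eq_forallb_in => e /andP[oe te].
rewrite ordered_cons_old // tree_of_cons in_setU1 negb_or (_ : e != d.1) //.
by apply: contraNneq dt => ed; rewrite /dart_vertex -ed; case: ifP.
Qed.

Lemma good_growthE t : dart_growth r t -> good_growth t = well_ordered t.
Proof.
elim: t => [_|d t IHt gdt /=]; last first.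
  by rewrite well_ordered_cons // IHt //; case/growth_consP: gdt.
by apply/esym; apply: forall_edges_within1.
Qed.

Lemma good_tree_of t : dart_growth r t -> spans r t ->
  good M (tree_of t) = good_growth t.
Proof.
move=> gt full; rewrite good_growthE //; apply: eq_forallb => e.
rewrite /edges_within /= !full /=; case eT: (e \in _) => //=.
rewrite /ordered.
by rewrite -(@precedes_filter _ (fun d => d.1 \notin tree_of t)) /= ?eT.
Qed.

End TourGrowth.

(** * Signed counts *)

Definition switches_at (A : eqType) (b : pred A) (s : seq A) (a : A) : bool :=
  all (fun a' => (a' != a) ==> (precedes s a' a == b a')) s.

(* Whatever [b a] is, [b] is [true] before [a] and [false] after it.  When both
   values occur, this leaves two adjacent choices of [a], whose signs cancel. *)
Lemma sum_sign_switch (R : pzRingType) (A : eqType) (b : pred A) (s : seq A) :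
    uniq s ->
  \sum_(a <- s | switches_at b s a) (-1) ^+ b a =
    (all (predC b) s)%:R - (all b s)%:R :> R.
Proof.
elim: s => [|y s IHs] /=; first by rewrite big_nil subrr.
case/andP=> ys Us; have yF a : a \in s -> (y == a) = false /\ (a == y) = false.
  by move=> a_s; rewrite eq_sym; have /negPf-> := memPn ys _ a_s.
have switches_head : switches_at b (y :: s) y = all (predC b) s.
  rewrite /switches_at /= eqxx; apply: eq_in_all => a /yF[ya ay].
  by rewrite /precedes /= ya ay eqxx; case: (b a).
have switches_tail a : a \in s ->
    switches_at b (y :: s) a = b y && switches_at b s a.
  move=> /yF[ya _]; rewrite /switches_at /= ya /precedes /= eqxx ya /=.
  congr (_ && _); apply: eq_in_all => a' /yF[ya' _].
  by rewrite ya' ltnS.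
have sum_tail : \sum_(a <- s | switches_at b (y :: s) a) (-1) ^+ b a =
    if b y then (all (predC b) s)%:R - (all b s)%:R else 0 :> R.
  rewrite big_seq_cond -IHs //; case by_: (b y); last first.
    by rewrite big_pred0 // => a; apply/andP => -[/switches_tail->];
      rewrite by_.
  rewrite [RHS]big_seq_cond; apply: eq_bigl => a; apply: andb_id2l => a_s.
  by rewrite switches_tail // by_.
rewrite big_cons switches_head sum_tail /=.
case: (b y); case: (all (predC b) s) => /=; rewrite ?subr0 ?addr0 //.
by rewrite addKr sub0r.
Qed.

Lemma forall_in_all (A : finType) (P b : pred A) (s : seq A) :
  s =i P -> [forall (a | P a), b a] = all b s.
Proof.
move=> sP; apply/forall_inP/allP => bs a; first by rewrite sP; apply: bs.
by rewrite -[P a]sP; apply: bs.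
Qed.

Section Weights.
Variables (R : comPzRingType) (G : digraph) (r : vertex G).
Implicit Types (d : dart G) (t : seq (dart G)) (z : vertex G).
Implicit Types (s w : seq (vertex G)).

Definition step_weight w z : R :=
  [forall (d | facing w z d), ~~ d.2]%:R - [forall (d | facing w z d), d.2]%:R.

Fixpoint weight s : R :=
  if s is z :: s' then step_weight (rcons s' r) z * weight s' else 1.

Definition linear_word w : bool :=
  [forall (e | edges_within w e), precedes w (origin e) (target e)].

Hypothesis loopless_G : loopless G.

Lemma linear_word_cons z w : z \notin w ->
  linear_word (z :: w) = [forall (d | facing w z d), ~~ d.2] && linear_word w.
Proof.
move=> zw; have zF u : u \in w -> (z == u) = false.
  by move=> uw; apply: contraNF zw => /eqP->.
rewrite /linear_word forall_edges_within_cons //; congr (_ && _); last first.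
  by apply: eq_forallb_in => e /andP[oe te]; rewrite /precedes /= !zF.
apply: eq_forallb_in => -[e b] /andP[/eqP]; rewrite /precedes /dart_vertex /=.
by case: b => /= -> od; rewrite eqxx (zF _ od).
Qed.

Lemma linear_word_rcons z w : z \notin w ->
  linear_word (rcons w z) = [forall (d | facing w z d), d.2] && linear_word w.
Proof.
move=> zw; have index_w u : u \in w -> index u (rcons w z) = index u w.
  by move=> uw; rewrite -cats1 index_cat uw.
have index_z : index z (rcons w z) = size w by rewrite -cats1 index_pivot.
transitivity [forall (e | edges_within (z :: w) e),
    precedes (rcons w z) (origin e) (target e)].
  by apply: eq_forallb => e; rewrite /edges_within /= !mem_rcons.
rewrite forall_edges_within_cons //; congr (_ && _); last first.
  by apply: eq_forallb_in => e /andP[oe te]; rewrite /precedes !index_w.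
apply: eq_forallb_in => -[e b] /andP[/eqP];
  rewrite /precedes /opp_vertex /dart_vertex /=.
case: b => /= -> od; rewrite index_z index_w // ?index_mem //.
by rewrite ltnNge ltnW // index_mem.
Qed.

Lemma sum_linear_spread s : uniq (rcons s r) ->
  \sum_(w <- spread r s | linear_word w) (-1) ^+ size (after r w) = weight s.
Proof.
elim: s => [|z s IHs] /=.
  move=> _; rewrite big_cons big_nil addr0 ifT //.
  exact: forall_edges_within1.
case/andP=> zs Us; rewrite big_cat !big_map /= -IHs // /step_weight mulrBl.
have spreadP w : w \in spread r s -> [/\ z \notin w, z != r & r \in w].
  move=> ws; have rw := spread_root ws; have zw : z \notin w.
    by rewrite (perm_mem (spread_perm ws)).
  by split=> //; apply: contraNneq zw => ->.
have eq_facing w (P : pred (dart G)) : w \in spread r s ->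
    [forall (d | facing w z d), P d] =
      [forall (d | facing (rcons s r) z d), P d].
  move/spread_perm/perm_mem => mem_w.
  by apply: eq_forallb => d; rewrite /facing /= mem_w.
congr (_ + _).
  rewrite big_distrr /= big_mkcond [RHS]big_mkcond; apply: eq_big_seq => w ws.
  have [zw zr _] := spreadP w ws.
  rewrite linear_word_cons // after_cons // (eq_facing w (fun d => ~~ d.2)) //.
  by rewrite andbC if_and mulr_natl mulrb.
rewrite -mulNr big_distrr /= big_mkcond [RHS]big_mkcond.
apply: eq_big_seq => w ws; have [zw _ rw] := spreadP w ws.
rewrite linear_word_rcons // after_rcons // size_rcons.
rewrite (eq_facing w (fun d => d.2)) //.
rewrite andbC if_and mulNr mulr_natl mulrb.
by case: ifP => // _; case: ifP => _; rewrite ?oppr0 // exprS mulN1r.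
Qed.

Definition dart_sign d : R := (-1) ^+ d.2.

Fixpoint growths_along s : seq (seq (dart G)) :=
  if s is z :: s' then
    [seq d :: t | t <- growths_along s', d <- enum (facing (rcons s' r) z)]
  else [:: [::]].

Lemma mem_growths_along s t : uniq (rcons s r) ->
  (t \in growths_along s) = (map (@dart_vertex G) t == s) && dart_growth r t.
Proof.
elim: s t => [|z s IHs] t /=; first by rewrite inE; case: t.
case/andP=> zs Us; apply/allpairsP/andP=> [[[t' d] /= []]|].
  rewrite IHs // => /andP[/eqP def_s gt'];
    rewrite mem_enum => /andP[/eqP dz od] ->.
  by rewrite /= dz /reached def_s zs od gt' !eqxx.
case: t => [|d t] [] // /eqP[dz def_s] /growth_consP[_ od gt].
exists (t, d); split=> //=; first by rewrite IHs // def_s eqxx.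
by rewrite mem_enum inE dz eqxx -def_s.
Qed.

Lemma uniq_growths_along s : uniq (growths_along s).
Proof.
elim: s => //= z s IHs; apply: allpairs_uniq => //; first exact: enum_uniq.
by move=> [t d] [t' d'] _ _ /= [-> ->].
Qed.

End Weights.

Section GoodWeights.
Variables (R : comPzRingType) (G : digraph) (M : rooted_map G).
Implicit Types (t : seq (dart G)) (z : vertex G) (s : seq (vertex G)).

Notation r := (Defs.root M).

Lemma sum_good_step t z : dart_growth r t ->
  \sum_(d <- enum (facing (dart_reached r t) z) | good_step M t d)
      dart_sign R d =
    step_weight R (dart_reached r t) z.
Proof.
move=> gt; set w := dart_reached r t.
pose s := [seq d <- map (@opp_dart G) (contour M t) | dart_vertex d == z].
have Us : uniq s.
  by rewrite filter_uniq // (map_inj_uniq (@opp_dart_inj G)) contour_uniq.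
have mem_s : s =i facing w z.
  move=> d; rewrite mem_filter -[d in d \in _]opp_dartK.
  by rewrite (mem_map (@opp_dart_inj G)) mem_contour.
rewrite /step_weight !(forall_in_all _ mem_s) -sum_sign_switch //.
rewrite (perm_big s) /=; last first.
  by apply: uniq_perm => [||d]; rewrite ?enum_uniq // mem_enum mem_s.
rewrite big_seq_cond [RHS]big_seq_cond; apply: eq_bigl => d.
rewrite /switches_at; case: (boolP (d \in s)) => //=;
  rewrite mem_s => /andP[/eqP dz _].
rewrite /good_step dz (forall_in_all _ mem_s); apply: eq_in_all => y /=.
rewrite mem_s => /andP[/eqP yz _]; congr (_ ==> (_ == _)).
rewrite precedes_filter ?yz ?dz //.
rewrite -[in RHS](opp_dartK y) -[in RHS](opp_dartK d).
by rewrite (precedes_map _ _ _ (@opp_dart_inj G)).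
Qed.

Lemma sum_good_growths_along s : uniq (rcons s r) ->
  \sum_(t <- growths_along r s | good_growth M t) \prod_(d <- t) dart_sign R d =
    weight R r s.
Proof.
elim: s => [|z s IHs] /=; first by rewrite big_cons /= !big_nil addr0.
case/andP=> _ Us; rewrite big_mkcond big_allpairs_dep /= -IHs // big_distrr /=.
rewrite [RHS]big_mkcond; apply: eq_big_seq => t;
  rewrite mem_growths_along // => /andP[/eqP def_s gt].
have rt : rcons s r = dart_reached r t by rewrite /reached def_s.
rewrite -big_mkcond rt -sum_good_step //; case: (good_growth M t); last first.
  by rewrite big_pred0 // => d; rewrite andbF.
by rewrite mulr_suml; apply: eq_big => [d|d _]; rewrite ?andbT // big_cons.
Qed.

End GoodWeights.

(** * Comparison of the expansions *)

Lemma big_seq_tuple (R : Type) (idx : R) (op : Monoid.com_law idx)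
    (A : finType) k (l : seq (seq A)) (f : seq A -> R) :
    uniq l -> {in l, forall s, size s = k} ->
  \big[op/idx]_(s <- l) f s = \big[op/idx]_(s : k.-tuple A | tval s \in l) f s.
Proof.
move=> Ul szl; rewrite -big_enum -(big_map (@tval k A) predT f) /=.
apply: perm_big; apply: uniq_perm => //.
  by rewrite map_inj_uniq ?enum_uniq //; apply: val_inj.
move=> s; apply/idP/mapP => [ls | [s']]; last by rewrite mem_enum => s'l ->.
have /eqP szs := szl _ ls; exists (Tuple szs) => //.
by rewrite mem_enum.
Qed.

Lemma uniq_full (A : finType) (s : seq A) :
  uniq s -> size s = #|A| -> forall a, a \in s.
Proof.
move=> Us szs a; have /subset_cardP : #|s| = #|A| by rewrite (card_uniqP Us).
by move/(_ (subset_predT _)) => ->.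
Qed.

Lemma xvar_inj (G : digraph) : injective (@xvar G).
Proof.
move=> u v /eqP; rewrite tofrac_eq => /eqP eqX; apply: enum_rank_inj.
have := congr1 (mcoeff U_(enum_rank u)) eqX.
rewrite !mcoeffX eqxx; case: eqP => [/mnmP/(_ (enum_rank u))|_ /eqP].
  by rewrite !mnm1E eqxx; case: eqP.
by rewrite oner_eq0.
Qed.

Section LoopCase.
Variables (G : digraph) (e : edge G).
Hypothesis loop : origin e = target e.

Lemma loop_Nnum : Nnum G = 0.
Proof. by rewrite /Nnum (bigD1 e) //= loop subrr mul0r mulr0. Qed.

Lemma loop_good_tree_sum (M : rooted_map G) : good_tree_sum M = 0.
Proof.
apply: big1 => T /andP[/andP[_ acyc] _];
  rewrite (bigD1 e) /= ?loop ?subrr ?mul0r //.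
by apply/negP => /(acyclic_loopless acyc)/eqP.
Qed.

End LoopCase.

Section RootExpansion.
Variables (G : digraph) (r : vertex G).

Notation V := (vertex G).
Notation K := (ratfun G).
Notation x := (@xvar G).
Notation k := (#|V|.-1).

Lemma card_vertexS : k.+1 = #|V|.
Proof. by rewrite prednK //; apply/card_gt0P; exists r. Qed.

Definition root_expansion : K :=
  \sum_(s : k.-tuple V | uniq (rcons s r))
    word_prod x (rcons s r) * weight K r s.

Lemma size_spanning_growth (t : seq (dart G)) :
  dart_growth r t -> spans r t -> size t = k.
Proof.
move=> gt full; apply/succn_inj; rewrite card_vertexS.
rewrite -(size_map (@dart_vertex G)) -(size_rcons _ r).
by rewrite -(card_uniqP (growth_uniq gt)); apply: eq_card.
Qed.

Lemma growth_spans (t : seq (dart G)) :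
  dart_growth r t -> size t = k -> spans r t.
Proof.
move=> gt szt; apply: uniq_full; first exact: growth_uniq gt.
by rewrite size_rcons size_map szt card_vertexS.
Qed.

Lemma prod_growth_edges t : dart_growth r t ->
  \prod_(e in tree_of t) (x (origin e) - x (target e))^-1 =
    \prod_(d <- t) (dart_sign K d * (x (dart_vertex d) - x (opp_vertex d))^-1).
Proof.
move=> gt; rewrite (eq_bigl (mem (map fst t))) => [|e]; last by rewrite inE.
rewrite -big_uniq ?(growth_edges_uniq gt) // big_map;
  apply: eq_bigr => -[e b] _.
rewrite /dart_sign /opp_vertex /dart_vertex; case: b; rewrite ?mul1r //=.
by rewrite mulN1r -invrN opprB.
Qed.

Lemma prod_tree_expansion (T : {set edge G}) : spanning_tree T ->
  \prod_(e in T) (x (origin e) - x (target e))^-1 =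
  \sum_(t : k.-tuple (dart G) | dart_growth r t && (tree_of t == T))
    \prod_(d <- t) dart_sign K d * word_prod x (dart_reached r t).
Proof.
case/(growth_exists r)=> t0 [gt0 full def_T].
rewrite -def_T prod_growth_edges // big_split /=.
rewrite -(sum_growth_orders (@xvar_inj G) gt0) big_distrr /= -big_filter.
rewrite (@big_seq_tuple _ _ _ _ k); last 2 first.
- by rewrite filter_uniq ?permutations_uniq.
- move=> t; rewrite mem_filter mem_permutations => /andP[_ /perm_size->].
  exact: size_spanning_growth.
apply: eq_big => t; rewrite mem_filter mem_permutations.
  apply: andb_id2l => gt; apply/idP/eqP => [/perm_tree_of // | ].
  exact: growth_tree_perm gt gt0.
by case/andP=> _ tt0; rewrite (perm_big _ tt0).
Qed.

Hypothesis loopless_G : loopless G.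

Lemma linear_extensionE (w : #|V|.-tuple V) :
  linear_extension w = uniq w && linear_word w.
Proof.
apply: andb_id2l => Uw; apply: eq_forallb => e.
by rewrite /edges_within /= !uniq_full // size_tuple.
Qed.

Lemma sum_linear_extension_spread (s : seq V) :
    uniq (rcons s r) -> size s = k ->
  \sum_(w : #|V|.-tuple V | linear_extension w && (tval w \in spread r s))
    (-1) ^+ size (after r w) = weight K r s.
Proof.
move=> Us szs; rewrite -(sum_linear_spread K loopless_G Us) -[RHS]big_filter.
rewrite (@big_seq_tuple _ _ _ _ #|V|) ?filter_uniq ?uniq_spread //; last first.
  move=> w; rewrite mem_filter => /andP[_ /spread_perm/perm_size->].
  by rewrite size_rcons szs card_vertexS.
apply: eq_bigl => w; rewrite mem_filter linear_extensionE -andbA;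
  apply: andb_idl.
by case/andP=> _ /spread_perm/perm_uniq->.
Qed.

Lemma Psi_root_expansion : Psi G = root_expansion.
Proof.
transitivity (\sum_(w : #|V|.-tuple V | linear_extension w)
    \sum_(s : k.-tuple V | tval w \in spread r s)
      (-1) ^+ size (after r w) * word_prod x (rcons s r)).
  apply: eq_bigr => w /andP[Uw _].
  have rw : r \in tval w by apply: uniq_full; rewrite ?size_tuple.
  rewrite -/(word_prod x w) (word_prod_spread_orders (@xvar_inj G) Uw rw).
  rewrite big_distrr /= (@big_seq_tuple _ _ _ _ k) ?uniq_spread_orders //.
    by apply: eq_bigl => s; rewrite mem_spread_orders.
  move=> s; rewrite mem_spread_orders // => /spread_perm/perm_size.
  by rewrite size_rcons size_tuple => ->.
rewrite (exchange_big_dep predT) //= [RHS]big_mkcond /=; apply: eq_bigr => s _.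
case: ifPn => Us.
  by rewrite -big_distrl sum_linear_extension_spread ?size_tuple // mulrC.
rewrite big_pred0 // => w.
apply: contraNF Us => /andP[/andP[Uw _] /spread_perm ws].
by rewrite -(perm_uniq ws).
Qed.

End RootExpansion.

Section GoodTrees.
Variables (G : digraph) (M : rooted_map G).
Hypothesis loopless_G : loopless G.

Notation r := (Defs.root M).
Notation V := (vertex G).
Notation K := (ratfun G).
Notation x := (@xvar G).
Notation k := (#|V|.-1).

Lemma sum_good_growth_tuple (s : seq V) : uniq (rcons s r) -> size s = k ->
  \sum_(t : k.-tuple (dart G) | (map (@dart_vertex G) t == s)
      && (dart_growth r t && good_growth M t)) \prod_(d <- t) dart_sign K d =
    weight K r s.
Proof.
move=> Us szs; rewrite -(sum_good_growths_along K Us) -[RHS]big_filter.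
rewrite (@big_seq_tuple _ _ _ _ k); last 2 first.
- by rewrite filter_uniq ?uniq_growths_along.
- move=> t; rewrite mem_filter mem_growths_along // => /and3P[_ /eqP st _].
  by rewrite -(size_map (@dart_vertex G)) st.
by apply: eq_bigl => t; rewrite mem_filter mem_growths_along // [LHS]andbA
  [LHS]andbC.
Qed.

Lemma good_tree_root_expansion :
  \sum_(T : {set edge G} | spanning_tree T && good M T)
    \prod_(e in T) (x (origin e) - x (target e))^-1 = root_expansion r.
Proof.
have goodE (t : k.-tuple _) : dart_growth r t ->
    spanning_tree (tree_of t) && good M (tree_of t) = good_growth M t.
  move=> gt; have full := growth_spans gt (size_tuple t).
  by rewrite (growth_spanning_tree gt) ?good_tree_of.
transitivity (\sum_(t : k.-tuple (dart G) | dart_growth r t && good_growth M t)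
    \prod_(d <- t) dart_sign K d * word_prod x (dart_reached r t)).
  rewrite (eq_bigr _ (fun T gT => prod_tree_expansion r (andP gT).1)).
  rewrite (exchange_big_dep
    (fun t : k.-tuple _ => dart_growth r t && good_growth M t)) /=.
    apply: eq_bigr => t /andP[gt gg]; rewrite (big_pred1 (tree_of t)) // => T.
    by rewrite gt /= [tree_of t == T]eq_sym; case: eqP => [->|_];
      rewrite ?andbF ?andbT ?goodE.
  by move=> T t gT /andP[gt /eqP def_T]; rewrite gt -goodE // def_T.
rewrite (partition_big (fun t : k.-tuple _ => map_tuple (@dart_vertex G) t)
   (fun s : k.-tuple V => uniq (rcons s r))) /=; last first.
  by move=> t /andP[/growth_uniq].
apply: eq_bigr => s Us.
rewrite -(sum_good_growth_tuple Us (size_tuple s)) big_distrr.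
apply: eq_big => [t|t /andP[_ /eqP <-]]; last by rewrite mulrC.
by rewrite andbC.
Qed.

Lemma Nnum_good_tree_sum : Nnum G = good_tree_sum M.
Proof.
rewrite /Nnum (Psi_root_expansion r) // -good_tree_root_expansion big_distrl.
apply: eq_bigr => T _; rewrite (bigID (mem T) predT) /= mulrA -big_split /=.
rewrite big1 ?mul1r // => e _.
by rewrite mulVf // subr_eq0 (inj_eq (@xvar_inj G)).
Qed.

End GoodTrees.

Theorem mainTheorem7 (G : digraph) (M : rooted_map G) (hconn : connected G) :
  Nnum G = good_tree_sum M /\
  (forall M' : rooted_map G, good_tree_sum M = good_tree_sum M').
Proof.
suff eqN M' : Nnum G = good_tree_sum M' by split=> [|M']; rewrite -!eqN.
have [e /= /eqP loop | loopless_G] :=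
  pickP [pred e : edge G | origin e == target e].
  by rewrite (loop_Nnum loop) (loop_good_tree_sum loop).
by apply: Nnum_good_tree_sum => e; have /= -> := loopless_G e.
Qed.
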